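(* Consider a convex multiobjective optimization problem $\min (f_1(x),\dots,f_m(x))$ subject to $c_1(x)\ge 0,\dots,c_l(x)\ge 0$ in $x\in\mathbb{R}^n$, where the $c_i$ are concave polynomials and the objectives have the form $$f_i(x)=h(x)+d_i^Tx,\quad i=1,\dots,m,$$ with $h$ a common convex polynomial and $d_1,\dots,d_m\in\mathbb{R}^n$. Suppose that $d_1,\dots,d_m$ are linearly independent. Then for each $x\in\mathcal{WP}$, the weight vector $w$ can be expressed in terms of $x$ and the Lagrange multiplier vector $\lambda$: whenever $w\in\mathbb{R}^m$ and $\lambda\in\mathbb{R}^l$ are a weight vector and a Lagrange multiplier vector associated with $x$ (see context), one has $$w=(D^TD)^{-1}D^T\big(\hat h_1(x)+\hat h_2(x,\lambda)\big),$$ where $$D=\begin{bmatrix}d_1&d_2&\cdots&d_m\\ 1&1&\cdots&1\end{bmatrix},\qquad \hat h_1(x)=\begin{bmatrix}-\nabla h(x)\\ 1\end{bmatrix},\qquad \hat h_2(x,\lambda)=\begin{bmatrix}\sum_{i=1}^l\lambda_i\nabla c_i(x)\\ 0\end{bmatrix}.$$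
   Context: Let $K=\{x\in\mathbb{R}^n: c_1(x)\ge 0,\dots,c_l(x)\ge 0\}$. A point $x^*\in K$ is a weakly Pareto point if there is no $x\in K$ with $f_i(x)<f_i(x^* )$ for all $i=1,\dots,m$; $\mathcal{WP}$ is the set of all weakly Pareto points. For $x\in\mathcal{WP}$, a weight vector $w$ and a Lagrange multiplier vector $\lambda$ associated with $x$ are vectors $w\in\mathbb{R}^m$ and $\lambda\in\mathbb{R}^l$ with $w\ge 0$, $w_1+\cdots+w_m=1$, satisfying the KKT conditions $$\sum_{j=1}^m w_j\nabla f_j(x)=\sum_{i=1}^l\lambda_i\nabla c_i(x),\qquad c_i(x)\ge 0,\ \lambda_i\ge 0,\ \lambda_ic_i(x)=0\ (i=1,\dots,l).$$ *)

(* Defs.v *)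
From HB Require Import structures.
From mathcomp Require Import all_boot all_order all_algebra.
From mathcomp Require Import classical_sets reals convex.
From mathcomp Require Import mpoly.

Set Implicit Arguments.
Unset Strict Implicit.
Unset Printing Implicit Defensive.

Import Order.TTheory GRing.Theory Num.Theory.
Local Open Scope classical_set_scope.
Local Open Scope ring_scope.

Definition peval (R : realType) (n : nat) (p : {mpoly R[n]}) (x : 'cV[R]_n) : R :=
  p.@[fun k => x k 0].

Definition grad (R : realType) (n : nat) (p : {mpoly R[n]}) (x : 'cV[R]_n) :
    'cV[R]_n :=
  \col_k peval (mderiv k p) x.

Definition convex_poly (R : realType) (n : nat) (p : {mpoly R[n]}) : Prop :=
  @convex_function R 'cV[R]_n setT (peval p).

Definition concave_poly (R : realType) (n : nat) (p : {mpoly R[n]}) : Prop :=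
  convex_poly (- p).

(* The polynomial h(x) + d^T x. *)
Definition objective (R : realType) (n : nat) (h : {mpoly R[n]}) (d : 'cV[R]_n) :
    {mpoly R[n]} :=
  h + \sum_(k < n) d k 0 *: 'X_k.

Definition feasible (R : realType) (n l : nat) (c : 'I_l -> {mpoly R[n]}) :
    set 'cV[R]_n :=
  [set x | forall i, 0 <= peval (c i) x].

Definition weakly_pareto (R : realType) (n m l : nat)
    (f : 'I_m -> {mpoly R[n]}) (c : 'I_l -> {mpoly R[n]}) : set 'cV[R]_n :=
  [set x | feasible c x /\
     ~ exists2 y, feasible c y & forall i, peval (f i) y < peval (f i) x].

Definition weight_multiplier (R : realType) (n m l : nat)
    (f : 'I_m -> {mpoly R[n]}) (c : 'I_l -> {mpoly R[n]})
    (x : 'cV[R]_n) (w : 'cV[R]_m) (lam : 'cV[R]_l) : Prop :=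
  [/\ forall j, 0 <= w j 0,
      \sum_j w j 0 = 1,
      \sum_j w j 0 *: grad (f j) x = \sum_i lam i 0 *: grad (c i) x &
      forall i, [/\ 0 <= peval (c i) x, 0 <= lam i 0
                  & lam i 0 * peval (c i) x = 0]].

Definition Dmx (R : realType) (n m : nat) (d : 'I_m -> 'cV[R]_n) :
    'M[R]_(n + 1, m) :=
  col_mx (\matrix_(k, j) d j k 0) (const_mx 1).

Definition hhat1 (R : realType) (n : nat) (h : {mpoly R[n]}) (x : 'cV[R]_n) :
    'cV[R]_(n + 1) :=
  col_mx (- grad h x) (const_mx 1).

Definition hhat2 (R : realType) (n l : nat) (c : 'I_l -> {mpoly R[n]})
    (x : 'cV[R]_n) (lam : 'cV[R]_l) : 'cV[R]_(n + 1) :=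
  col_mx (\sum_i lam i 0 *: grad (c i) x) 0.

(* Main.v *)
Require Import Defs.
From HB Require Import structures.
From mathcomp Require Import all_boot all_order all_algebra.
From mathcomp Require Import classical_sets reals convex.
From mathcomp Require Import mpoly.

Import Order.TTheory GRing.Theory Num.Theory.
Local Open Scope ring_scope.

(** The KKT stationarity condition together with [\sum_j w_j = 1] says exactly
    that [D w = hhat1 + hhat2]. The columns of [D] are linearly independent
    because those of its top block are, so the Gram matrix [D^T D] is invertible
    and [w] is recovered by the normal equations. *)

(** The single entry of [v^T *m v] is a sum of squares; in an ordered domain such a sum vanishes
    only if every square does. *)
Lemma trmx_mul_eq0 (R : realDomainType) (p : nat) (v : 'cV[R]_p) :
  v^T *m v = 0 -> v = 0.
Proof.
move=> /matrixP/(_ 0 0); rewrite !mxE => vv0.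
have v2_ge0 (i : 'I_p) : true -> 0 <= v^T 0 i * v i 0.
  by rewrite mxE -expr2 sqr_ge0.
apply/colP => i.
have : v^T 0 i * v i 0 = 0 by exact: (psumr_eq0P v2_ge0 vv0).
by rewrite !mxE -expr2 => /eqP; rewrite sqrf_eq0 => /eqP.
Qed.

(** A row vector [u] killed by the Gram matrix satisfies [(A u^T)^T (A u^T) = u A^T A u^T = 0], so
    [A u^T = 0] and injectivity gives [u = 0]: the left kernel is trivial. *)
Lemma gram_unitmx (R : realFieldType) (p m : nat) (A : 'M[R]_(p, m)) :
  (forall v : 'cV[R]_m, A *m v = 0 -> v = 0) -> A^T *m A \in unitmx.
Proof.
move=> A_inj; rewrite -row_free_unit -kermx_eq0; apply/eqP/row_matrixP => i.
rewrite row0; set u := row i _.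
have uA0 : u *m (A^T *m A) = 0 by rewrite -row_mul mulmx_ker row0.
have : A *m u^T = 0.
  apply: trmx_mul_eq0.
  by rewrite trmx_mul trmxK -mulmxA [A^T *m _]mulmxA mulmxA uA0 mul0mx.
by move=> /A_inj/(congr1 trmx); rewrite trmxK trmx0.
Qed.

Lemma grad_objective (R : realType) (n : nat) (h : {mpoly R[n]})
    (d x : 'cV[R]_n) : grad (objective h d) x = grad h x + d.
Proof.
apply/colP => k; rewrite !mxE /peval /objective linearD /= mevalD; congr (_ + _).
rewrite [mderiv _ _]linear_sum (big_morph _ (mevalD _) (meval0 _)).
rewrite (bigD1 k) //= big1 => [|i /negPf ik].
  rewrite linearZ /= mderivX mnm1E eqxx scale1r mevalZ.
  (* The derivative of ['X_k] is the monomial with exponent [U_(k) - U_(k) = 0], that is, the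
     constant 1. *)
  by rewrite -{1}[U_(k)%MM]add0m addmK mpolyX0 meval1 mulr1 addr0.
by rewrite linearZ /= mderivX mnm1E ik scale0r scaler0 meval0.
Qed.

Lemma mulmx_matrix_cols (R : realType) (n m : nat) (d : 'I_m -> 'cV[R]_n)
    (w : 'cV[R]_m) : (\matrix_(k, j) d j k 0) *m w = \sum_j w j 0 *: d j.
Proof.
apply/colP => k; rewrite mxE summxE; apply: eq_bigr => j _.
by rewrite !mxE mulrC.
Qed.

Lemma Dmx_mul_inj (R : realType) (n m : nat) (d : 'I_m -> 'cV[R]_n) :
  free [tuple d j | j < m] ->
  forall v : 'cV[R]_m, Dmx d *m v = 0 -> v = 0.
Proof.
move=> /freeP d_free v; rewrite /Dmx mul_col_mx -(col_mx0 _ n 1).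
move=> /eq_col_mx[+ _]; rewrite mulmx_matrix_cols => dv0.
apply/colP => j; rewrite [RHS]mxE; apply: (d_free (fun j => v j 0)).
by rewrite -[RHS]dv0; apply: eq_bigr => i _; rewrite -tnth_nth tnth_mktuple.
Qed.

Lemma Dmx_weight (R : realType) (n m l : nat) (h : {mpoly R[n]})
    (d : 'I_m -> 'cV[R]_n) (c : 'I_l -> {mpoly R[n]}) (x : 'cV[R]_n)
    (w : 'cV[R]_m) (lam : 'cV[R]_l) :
  weight_multiplier (fun j => objective h (d j)) c x w lam ->
  Dmx d *m w = hhat1 h x + hhat2 c x lam.
Proof.
case=> _ w_sum1 stationary _.
rewrite /Dmx /hhat1 /hhat2 mul_col_mx add_col_mx addr0 mulmx_matrix_cols.
(* The row of ones turns the bottom block into the normalization of the weights. *)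
congr col_mx; last first.
  apply/colP => i; rewrite !mxE -[RHS]w_sum1.
  by apply: eq_bigr => j _; rewrite mxE mul1r.
(* Since the weights sum to 1, the common term [grad h x] appears exactly once in the stationarity
   sum and cancels against [- grad h x] from [hhat1]. *)
rewrite -stationary; under [in RHS]eq_bigr do rewrite grad_objective scalerDr.
by rewrite big_split /= -scaler_suml w_sum1 scale1r addKr.
Qed.

Theorem proposition3p4 (R : realType) (n m l : nat)
    (h : {mpoly R[n]}) (d : 'I_m -> 'cV[R]_n) (c : 'I_l -> {mpoly R[n]})
    (h_convex : convex_poly h)
    (c_concave : forall i, concave_poly (c i))
    (d_free : free [tuple d j | j < m]) :
  (Dmx d)^T *m Dmx d \in unitmx /\
  forall (x : 'cV[R]_n),
    weakly_pareto (fun j => objective h (d j)) c x ->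
    forall (w : 'cV[R]_m) (lam : 'cV[R]_l),
      weight_multiplier (fun j => objective h (d j)) c x w lam ->
      w = invmx ((Dmx d)^T *m Dmx d) *m (Dmx d)^T *m (hhat1 h x + hhat2 c x lam).
Proof.
have DTD_unit := gram_unitmx _ _ _ _ (Dmx_mul_inj _ _ _ _ d_free).
split=> // x _ w lam /Dmx_weight <-.
(* With the right-hand side written as [D w], the Gram matrix meets its inverse and only [w]
   remains. *)
by rewrite -mulmxA [_^T *m (_ *m w)]mulmxA mulKmx.
Qed.
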